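(* Let $K$ be a field of prime characteristic $p>0$, let $R=K[x_1,\ldots,x_d]$ be the polynomial ring, and let $\mathfrak{m}\subseteq R$ be the ideal generated by $x_1,\ldots,x_d$. Then the $F$-threshold of the differential power filtration $\mathfrak{m}^{\langle\bullet\rangle}=\{\mathfrak{m}^{\langle i\rangle}\}_{i\geq 0}$ with respect to $\mathfrak{m}$ satisfies $$\mathcal{C}^{\mathfrak{m}}(\mathfrak{m}^{\langle\bullet\rangle})=d.$$
   Context: $\mathbb{N}$ includes $0$. Differential operators: the $K$-linear differential operators on $R$ of order at most $n$ are defined inductively by $D_R^0=\operatorname{End}_R(R)=R\subseteq \operatorname{End}_K(R)$ (multiplications by elements of $R$) and, for $n\geq 1$, $D_R^n=\{\delta\in\operatorname{End}_K(R)\;|\;\delta f-f\delta\in D_R^{n-1}\text{ for every } f\in R\}$. For the polynomial ring $R=K[x_1,\ldots,x_d]$, $D_R^n$ is the free $R$-module generated by the divided-power operators $\frac{1}{\alpha_1!}\frac{\partial^{\alpha_1}}{\partial x_1^{\alpha_1}}\cdots\frac{1}{\alpha_d!}\frac{\partial^{\alpha_d}}{\partial x_d^{\alpha_d}}$ with $\alpha_1+\cdots+\alpha_d\leq n$. Differential powers: for an ideal $I\subseteq R$ and $n\geq 1$, $I^{\langle n\rangle}=\{f\in R\;|\;\delta(f)\in I\text{ for all }\delta\in D_R^{n-1}\}$, and $I^{\langle 0\rangle}=R$. Filtrations: a filtration of ideals $\mathfrak{a}_\bullet=\{\mathfrak{a}_i\}_{i\geq 0}$ is a sequence of ideals with $\mathfrak{a}_0=R$,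 $\mathfrak{a}_{i+1}\subseteq\mathfrak{a}_i$ and $\mathfrak{a}_i\mathfrak{a}_j\subseteq\mathfrak{a}_{i+j}$ for all $i,j\geq 0$. In the polynomial ring, the sequence $I^{\langle\bullet\rangle}=\{I^{\langle i\rangle}\}_{i\geq 0}$ is a filtration of ideals. $F$-thresholds: for an ideal $J$, $J^{[p^e]}$ denotes the ideal generated by the $p^e$-th powers of the elements of $J$. For a filtration $\mathfrak{a}_\bullet$ and $e\in\mathbb{N}$, put $\nu_{\mathfrak{a}_\bullet}^J(p^e)=\sup\{t\in\mathbb{N}\;|\;\mathfrak{a}_t\not\subseteq J^{[p^e]}\}$, $\mathcal{C}_+^J(\mathfrak{a}_\bullet)=\limsup_{e\to\infty}\nu_{\mathfrak{a}_\bullet}^J(p^e)/p^e$ and $\mathcal{C}_-^J(\mathfrak{a}_\bullet)=\liminf_{e\to\infty}\nu_{\mathfrak{a}_\bullet}^J(p^e)/p^e$, as elements of $\mathbb{R}_{\geq 0}\cup\{\pm\infty\}$. The $F$-threshold $\mathcal{C}^J(\mathfrak{a}_\bullet)$ exists if $\mathcal{C}_+^J(\mathfrak{a}_\bullet)=\mathcal{C}_-^J(\mathfrak{a}_\bullet)\in\mathbb{R}_{\geq 0}$, and is then this common value; the claim includes that it exists. *)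

(* Defs.v *)
(* mpoly is imported without its notations, which clash with those of
   MathComp-Analysis: [mpoly d K] is the type {mpoly K[d]}. *)
From HB Require Import structures.
From mathcomp Require Import all_boot all_order all_algebra.
From mathcomp Require Import all_classical all_reals all_analysis.
From mathcomp Require Import -(notations) mpoly.
Set Implicit Arguments.
Unset Strict Implicit.
Unset Printing Implicit Defensive.
Import Order.TTheory GRing.Theory Num.Theory.

Local Open Scope classical_set_scope.
Local Open Scope ring_scope.

Definition is_ideal (A : comNzRingType) (I : set A) : Prop :=
  [/\ I 0,
      forall f g, I f -> I g -> I (f + g) &
      forall f g, I g -> I (f * g)].

Definition ideal_gen (A : comNzRingType) (S : set A) : set A :=
  smallest (@is_ideal A) S.

(* J^{[q]}; the Frobenius power when q = p^e *)
Definition bracket_power (A : comNzRingType) (J : set A) (q : nat) : set A :=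
  ideal_gen [set f ^+ q | f in J].

(* D_A^n, as a set of maps A -> A; [linear] is K-linearity *)
Fixpoint diff_op (K : fieldType) (A : comAlgType K) (n : nat) : set (A -> A) :=
  if n is n'.+1 then
    [set delta : A -> A | linear delta /\
       forall f : A, diff_op n' (fun g => delta (f * g) - f * delta g)]
  else [set (fun g => f * g) | f in [set: A]].

Definition diff_power (K : fieldType) (A : comAlgType K) (I : set A) (n : nat) :
    set A :=
  if n is n'.+1 then
    [set f | forall delta : A -> A, diff_op n' delta -> I (delta f)]
  else [set: A].

Section FThresholds.
Local Open Scope ereal_scope.
Variables (R : realType) (A : comNzRingType) (p : nat).
Variables (J : set A) (a : nat -> set A).

(* The supremum is taken in \bar R: +oo if unbounded, -oo if empty. *)
Definition nu (e : nat) : \bar R :=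
  ereal_sup [set (t%:R)%:E | t in
              [set t : nat | ~ (a t `<=` bracket_power J (p ^ e)%N)]].

Definition Fthreshold_upper : \bar R :=
  limn_esup (fun e : nat => nu e / ((p ^ e)%N%:R)%:E).

Definition Fthreshold_lower : \bar R :=
  limn_einf (fun e : nat => nu e / ((p ^ e)%N%:R)%:E).

(* The F-threshold of [a] with respect to J exists and equals c. *)
Definition is_Fthreshold (c : R) : Prop :=
  [/\ (0 <= c)%R, Fthreshold_upper = c%:E & Fthreshold_lower = c%:E].
End FThresholds.

Definition max_ideal (K : fieldType) (d : nat) : set (mpoly d K) :=
  ideal_gen (range (fun i : 'I_d => mpolyX K (mnm1 i))).
Arguments max_ideal : clear implicits.

(* Main.v *)
Require Import Defs.
From HB Require Import structures.
From mathcomp Require Import all_boot all_order all_algebra.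
From mathcomp Require Import all_classical all_reals all_analysis.
From mathcomp Require Import -(notations) mpoly.
Set Implicit Arguments.
Unset Strict Implicit.
Unset Printing Implicit Defensive.
Import Order.TTheory GRing.Theory Num.Theory.
Import numFieldNormedType.Exports.
Local Open Scope ring_scope.

(** Write [q = p ^ e].  The point is that [nu e = d * (q - 1)] exactly, so that
    [nu e / q = d - d / q] converges to [d].

    The power [m^[q]] is the monomial ideal spanned by the monomials having
    some exponent at least [q] ([max_ideal_bracket]): it contains these
    monomials, and conversely the [q]-th power map is additive, so the
    polynomials whose [q]-th power lies in the monomial ideal form an ideal,
    which contains the variables.  Membership of a polynomial in [m^[q]] is thus
    the vanishing of its coefficients at the exponents in the box [0, q)^d, whose
    largest element is the corner (q - 1, ..., q - 1), of degree [d * (q - 1)].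

    The differential power [m^<t>] sees the degree only.  On the one hand, an
    operator of order less than [t] sends a monomial of degree at least [t] into
    [m] ([diff_op_monomial]), because commuting one variable past the operator
    lowers the order by one; so the corner monomial lies in [m^<d * (q - 1)>] and
    not in [m^[q]].  On the other hand, the coefficient at [a] of a polynomial
    [f] is the constant term of the divided power derivative of [f] of index [a],
    an operator of order [mdeg a]; so an element of [m^<t>] has no term of degree
    less than [t] ([diff_power_mcoeff]), and it lies in [m^[q]] when
    [t > d * (q - 1)].

    The divided power derivatives are obtained, without binomial coefficients, as
    the coefficients in [y] of the Taylor expansion [f (x + y)], which is a ring
    morphism in [f]. *)

(** * Ideals generated by a set *)

Lemma ideal_genP (A : comNzRingType) (S : set A) : is_ideal (ideal_gen S).
Proof.
split=> [I [[]]//|f g If Ig I IS|f g Ig I IS].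
  by have [[_ + _] _] := IS; apply; [exact: If | exact: Ig].
by have [[_ _ +] _] := IS; apply; exact: Ig.
Qed.

Lemma ideal_sum (A : comNzRingType) (I : set A) (T : Type) (r : seq T)
    (F : T -> A) :
  is_ideal I -> (forall i, I (F i)) -> I (\sum_(i <- r) F i).
Proof. by case=> I0 ID _ IF; apply: (big_ind I). Qed.

(** * Differential operators *)

Section DiffOp.
Variables (K : fieldType) (A : comAlgType K).
Implicit Types (n : nat) (delta : A -> A).

Lemma diff_op0 n : diff_op n (fun _ : A => 0).
Proof.
elim: n => [|n IHn] /=; first by exists 0 => //; apply/funext => g; rewrite mul0r.
split=> [a u v|f]; first by rewrite scaler0 addr0.
by under eq_fun do rewrite mulr0 subrr.
Qed.

Lemma diff_opD n delta1 delta2 : diff_op n delta1 -> diff_op n delta2 ->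
  diff_op n (fun g => delta1 g + delta2 g).
Proof.
elim: n delta1 delta2 => [|n IHn] delta1 delta2 /=.
  case=> f1 _ <- [f2 _ <-]; exists (f1 + f2) => //.
  by apply/funext => g; rewrite mulrDl.
move=> [lin1 D1] [lin2 D2]; split=> [a u v|f].
  by rewrite lin1 lin2 scalerDr addrACA.
have := IHn _ _ (D1 f) (D2 f); congr (diff_op n _).
by apply/funext => g; rewrite mulrDr opprD addrACA.
Qed.

Lemma diff_opM n h delta : diff_op n delta -> diff_op n (fun g => h * delta g).
Proof.
elim: n delta => [|n IHn] delta /=.
  case=> f _ <-; exists (h * f) => //.
  by apply/funext => g; rewrite mulrA.
move=> [lin D]; split=> [a u v|f]; first by rewrite lin mulrDr scalerAr.
have := IHn _ (D f); congr (diff_op n _).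
by apply/funext => g; rewrite mulrBr mulrCA.
Qed.

Lemma diff_op_sum n (I : Type) (r : seq I) (P : pred I) (F : I -> A -> A) :
  (forall i, P i -> diff_op n (F i)) ->
  diff_op n (fun g => \sum_(i <- r | P i) F i g).
Proof.
move=> DF; elim: r => [|i r IHr].
  under eq_fun do rewrite big_nil.
  exact: diff_op0.
under eq_fun do rewrite big_cons.
by case Pi: (P i) => //; apply: diff_opD IHr; exact: DF.
Qed.

End DiffOp.

(** * Taylor expansion and divided power derivatives *)

Section Polynomials.
Variables (K : fieldType) (d : nat).
Local Notation P := (mpoly d K).
Local Notation var i := (mpolyX K (mnm1 i)) (only parsing).
Implicit Types (f g : P) (m a : multinom d).

Lemma mpoly_rmorph_eq (S : comNzRingType) (phi psi : {rmorphism P -> S}) :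
  (forall c : K, phi (mpolyC d c) = psi (mpolyC d c)) ->
  (forall i : 'I_d, phi (var i) = psi (var i)) ->
  phi =1 psi.
Proof.
move=> eqC eqX f; rewrite (mpolyE f) !rmorph_sum; apply: eq_bigr => m _.
rewrite -mul_mpolyC mpolyXE_id !rmorphM !rmorph_prod eqC; congr (_ * _).
by apply: eq_bigr => i _; rewrite !rmorphXn eqX.
Qed.

(** The polynomial [f (x + y)], as a polynomial in the outer variables [y] over
    the ring of polynomials in [x]. *)
Definition taylor : P -> mpoly d P :=
  mmap (@mpolyC d P \o @mpolyC d K)
       (fun i => mpolyC d (var i) + mpolyX P (mnm1 i)).

HB.instance Definition _ := GRing.RMorphism.on taylor.

Lemma taylorC (c : K) : taylor (mpolyC d c) = mpolyC d (mpolyC d c).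
Proof. by rewrite /taylor mmapC. Qed.

Lemma taylorX i : taylor (var i) = mpolyC d (var i) + mpolyX P (mnm1 i).
Proof. by rewrite /taylor mmapX mmap1U. Qed.

(** The divided power derivative of index [a], since the Taylor expansion of [f]
    is the sum of its values on [f] multiplied by the powers of [y]. *)
Definition hasse a f : P := mcoeff a (taylor f).

Lemma hasse_linear a : linear (hasse a).
Proof.
move=> c f g; rewrite /hasse -mul_mpolyC rmorphD rmorphM /= taylorC.
by rewrite mcoeffD mcoeffCM mul_mpolyC.
Qed.

(** Setting [y = 0] in [f (x + y)] gives [f (x)]. *)
Lemma hasse0 f : hasse (@mnm0 d) f = f.
Proof.
apply: (@mpoly_rmorph_eq _ (mcoeff (@mnm0 d) \o taylor) idfun) => [c|i] /=.
  by rewrite taylorC mpolyCK.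
by rewrite taylorX mcoeffD mpolyCK mcoeffX mnm1_eq0 addr0.
Qed.

(** Setting [x = 0] in [f (x + y)] gives [f (y)]. *)
Lemma mcoeff0_hasse a f : mcoeff (@mnm0 d) (hasse a f) = mcoeff a f.
Proof.
rewrite -mcoeff_map_mpoly; congr mcoeff.
apply: (@mpoly_rmorph_eq _ (map_mpoly (mcoeff (@mnm0 d)) \o taylor) idfun).
  by move=> c /=; rewrite taylorC map_mpolyC /= mpolyCK.
move=> i /=; rewrite taylorX rmorphD /= map_mpolyC map_mpolyX /= mcoeffX.
by rewrite mnm1_eq0 mpolyC0 add0r.
Qed.

(** As the Taylor expansion is multiplicative, [hasse a (f * g) - f * hasse a g]
    is the coefficient at [a] of the product of [taylor f - f] and [taylor g].
    The first factor has no term of degree 0 in [y], so only derivatives of [g]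
    of order less than [mdeg a] occur. *)
Lemma hasse_diff_op n a : (mdeg a <= n)%N -> diff_op n (hasse a).
Proof.
elim: n a => [|n IHn] a le_an /=.
  have -> : a = @mnm0 d by apply/eqP; rewrite -mdeg_eq0 -leqn0.
  by exists 1 => //; apply/funext => g; rewrite hasse0 mul1r.
split=> [|f]; first exact: hasse_linear.
set Q := taylor f - mpolyC d f.
have commE g : hasse a (f * g) - f * hasse a g =
    \sum_(k : bmultinom d (mdeg a).+1 * bmultinom d (mdeg a).+1
            | a == mnm_add k.1 k.2) mcoeff k.1 Q * hasse k.2 g.
  by rewrite -mcoeffM mulrBl mcoeffB mcoeffCM -rmorphM.
under eq_fun do rewrite commE.
apply: diff_op_sum => k /eqP a_k.
have [k1_0|k1_neq0] := eqVneq (val k.1) (@mnm0 d).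
  have Q0 : mcoeff (@mnm0 d) Q = 0.
    by rewrite mcoeffB mpolyCK -[X in X - _]/(hasse (@mnm0 d) f) hasse0 subrr.
  under eq_fun do rewrite k1_0 Q0 mul0r.
  exact: diff_op0.
apply/diff_opM/IHn; rewrite -ltnS; apply: leq_trans le_an.
by rewrite [X in (_ < mdeg X)%N]a_k mdegD -add1n leq_add2r lt0n mdeg_eq0.
Qed.

(** * Differential powers of the maximal ideal *)

Lemma max_idealX i : max_ideal K d (var i).
Proof. by apply: sub_gen_smallest; exists i. Qed.

Lemma max_ideal_mcoeff0 f : max_ideal K d f -> mcoeff (@mnm0 d) f = 0.
Proof.
move: f; apply: smallest_sub => [|_ [i _ <-]].
  split=> [|f g /= f0 g0|f g /= g0]; first exact: mcoeff0.
    by rewrite mcoeffD f0 g0 addr0.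
  by rewrite rmorphM /= g0 mulr0.
by rewrite /= mcoeffX mnm1_eq0.
Qed.

Lemma diff_power_mcoeff t f a :
  diff_power (max_ideal K d) t f -> (mdeg a < t)%N -> mcoeff a f = 0.
Proof.
case: t => // t ft; rewrite ltnS => le_at.
rewrite -mcoeff0_hasse; apply: max_ideal_mcoeff0; apply: ft.
exact: hasse_diff_op.
Qed.

Lemma mpolyX_factor m : (0 < mdeg m)%N ->
  exists i m', mpolyX K m = var i * mpolyX K m' /\ mdeg m = (mdeg m').+1.
Proof.
move=> m_gt0; have [i m_i] : exists i : 'I_d, (0 < m i)%N.
  apply/existsP; apply: contraLR m_gt0 => /existsPn m0.
  by rewrite mdegE big1 // => i _; apply/eqP; rewrite -leqn0 leqNgt.
have mE : mnm_add (mnm_sub m (mnm1 i)) (mnm1 i) = m.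
  by apply: submK; apply/mnm_lepP => j; rewrite mnm1E; case: eqP => [<-|].
exists i, (mnm_sub m (mnm1 i)); rewrite -{1 3}mE mpolyXD mulrC.
by rewrite mdegD mdeg1 addn1.
Qed.

(** With [x_i] dividing the monomial, [delta (x_i * g)] differs from
    [x_i * delta g], which is in [m], by the value at [g] of the commutator of
    [delta] with [x_i]: both the order and the degree have dropped by one. *)
Lemma diff_op_monomial n (delta : P -> P) m :
  diff_op n delta -> (n < mdeg m)%N -> max_ideal K d (delta (mpolyX K m)).
Proof.
have [_ mD mM] : is_ideal (max_ideal K d) := ideal_genP _.
elim: n delta m => [|n IHn] delta m D_delta lt_nm.
all: have /mpolyX_factor[i [m' [-> degE]]] := leq_ltn_trans (leq0n _) lt_nm.
  case: D_delta => h _ <-.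
  by rewrite mulrCA mulrC; apply: mM; exact: max_idealX.
case: D_delta => _ D_comm.
rewrite -[delta _](subrK (var i * delta (mpolyX K m'))).
apply: mD; last by rewrite mulrC; apply: mM; exact: max_idealX.
by apply: (IHn _ m' (D_comm (var i))); rewrite -ltnS -degE.
Qed.

(** * Frobenius powers of the maximal ideal *)

(** The span of the monomials having some exponent at least [q]. *)
Definition outside_box (q : nat) : set P :=
  [set f | forall m, (forall i, (m i < q)%N) -> mcoeff m f = 0].

Lemma outside_box_ideal q : is_ideal (outside_box q).
Proof.
split=> [m _|f g f0 g0 m m_q|f g g0 m m_q]; first exact: mcoeff0.
  by rewrite mcoeffD f0 // g0 // addr0.
rewrite mcoeffM big1 // => k /eqP m_k; rewrite (g0 k.2) ?mulr0 // => i.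
apply: leq_ltn_trans (m_q i).
by rewrite [leqRHS](congr1 (fun a => a i) m_k) mnmDE leq_addl.
Qed.

Lemma outside_box_sub_bracket q :
  (outside_box q `<=` bracket_power (max_ideal K d) q)%classic.
Proof.
have bI : is_ideal (bracket_power (max_ideal K d) q) := ideal_genP _.
move=> f f0; rewrite (mpolyE f); apply: (ideal_sum _ bI) => m.
rewrite -mul_mpolyC; case: (bI) => b0 _ bM.
have [/existsP[i q_mi]|] := boolP [exists i : 'I_d, (q <= m i)%N].
  apply: (bM); rewrite mpolyXE_id (bigD1 i) //= mulrC -(subnK q_mi) exprD mulrA.
  apply: bM; apply: sub_gen_smallest; exists (var i) => //; exact: max_idealX.
rewrite negb_exists => /forallP m_q; rewrite f0 ?mpolyC0 ?mul0r // => i.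
by rewrite ltnNge.
Qed.

Lemma bracket_sub_outside_box p e : p \in [pchar K] ->
  (bracket_power (max_ideal K d) (p ^ e) `<=` outside_box (p ^ e))%classic.
Proof.
move=> charK; have [M0 MD MM] := outside_box_ideal (p ^ e).
have p_pr := pcharf_prime charK.
have q_pchar : [pchar P].-nat (p ^ e)%N.
  by rewrite pnatX pnatE // (rmorph_pchar (@mpolyC d K) charK).
apply: smallest_sub; first exact: outside_box_ideal.
(* The preimage of an ideal by the q-th power map is an ideal, since this map is
   a ring endomorphism in characteristic p. *)
suff root_ideal : (max_ideal K d `<=`
    [set f | outside_box (p ^ e) (f ^+ (p ^ e))])%classic.
  by move=> _ [f /root_ideal + <-].
apply: smallest_sub => [|_ [i _ <-] m m_q].
  split=> [|f g /= Mf Mg|f g /= Mg].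
  - by rewrite /= expr0n expn_eq0 eqn0Ngt prime_gt0.
  - by rewrite exprDn_pchar //; apply: MD.
  - by rewrite exprMn; apply: MM.
rewrite mcoeffXn; case: eqP => // mE; have := m_q i.
by rewrite -mE mulmnE mnm1E eqxx mul1n ltnn.
Qed.

Lemma max_ideal_bracket p e : p \in [pchar K] ->
  bracket_power (max_ideal K d) (p ^ e) = outside_box (p ^ e).
Proof.
move=> charK; apply/seteqP; split; first exact: bracket_sub_outside_box.
exact: outside_box_sub_bracket.
Qed.

(** The exponents in the box have degree at most that of its corner. *)
Lemma diff_power_sub_bracket t q : (d * (q - 1) < t)%N ->
  (diff_power (max_ideal K d) t `<=` bracket_power (max_ideal K d) q)%classic.
Proof.
move=> lt_t f ft; apply: outside_box_sub_bracket => m m_q.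
apply: (diff_power_mcoeff ft); apply: leq_ltn_trans lt_t.
rewrite mdegE; apply: (@leq_trans (\sum_(i < d) (q - 1))).
  by apply: leq_sum => i _; have := m_q i; case: (q) => // q'; rewrite subn1.
by rewrite sum_nat_const card_ord.
Qed.

Lemma diff_power_not_sub_bracket p e : p \in [pchar K] ->
  ~ (diff_power (max_ideal K d) (d * (p ^ e - 1)) `<=`
     bracket_power (max_ideal K d) (p ^ e))%classic.
Proof.
move=> charK; rewrite max_ideal_bracket //.
have q_gt0 : (0 < p ^ e)%N by rewrite expn_gt0 prime_gt0 // (pcharf_prime charK).
pose corner : multinom d :=
  mnm_muln (\big[@mnm_add d/@mnm0 d]_(i < d) mnm1 i) (p ^ e - 1).
have cornerE i : corner i = (p ^ e - 1)%N.
  rewrite /corner mulmnE mnm_sumE (bigD1 i) //= mnm1E eqxx big1 ?addn0 ?mul1n //.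
  by move=> j ji; rewrite mnm1E (negbTE ji).
move=> /(_ (mpolyX K corner)) sub.
have /sub : diff_power (max_ideal K d) (d * (p ^ e - 1)) (mpolyX K corner).
  have : mdeg corner = (d * (p ^ e - 1))%N.
    by rewrite mdegE (eq_bigr _ (fun i _ => cornerE i)) sum_nat_const card_ord.
  case: (d * _)%N => // t deg_corner delta D_delta.
  by apply: diff_op_monomial D_delta _; rewrite deg_corner.
move=> /(_ corner) corner0; have : mcoeff corner (mpolyX K corner) = 0.
  by apply: corner0 => i; rewrite cornerE subn1 prednK.
by rewrite mcoeffX eqxx => /eqP; rewrite oner_eq0.
Qed.

End Polynomials.

(** * The threshold *)

Lemma nu_max_ideal (R : realType) (K : fieldType) (p d e : nat) :
  p \in [pchar K] ->
  nu R p (max_ideal K d) (diff_power (max_ideal K d)) e =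
  ((d * (p ^ e - 1))%N%:R)%:E.
Proof.
move=> charK; apply/eqP; rewrite eq_le; apply/andP; split.
  apply: ge_ereal_sup => _ [t /= not_sub <-]; rewrite lee_fin ler_nat leqNgt.
  by apply/negP => /(@diff_power_sub_bracket K).
apply: ereal_sup_ubound; exists (d * (p ^ e - 1))%N => //=.
exact: diff_power_not_sub_bracket.
Qed.

Lemma cvg_box_ratio (R : realType) (p d : nat) : (1 < p)%N ->
  ((fun e => (d * (p ^ e - 1))%N%:R / (p ^ e)%N%:R : R) @ \oo -->
     (d%:R : R))%classic.
Proof.
move=> p_gt1; have p_gt0 : (0 < p)%N := ltnW p_gt1.
have -> : (fun e => (d * (p ^ e - 1))%N%:R / (p ^ e)%N%:R : R) =
          (fun e => d%:R - d%:R * (p%:R^-1) ^+ e).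
  apply/funext => e; rewrite natrM natrB ?expn_gt0 ?p_gt0 // natrX exprVn.
  rewrite mulrBr mulr1 mulrBl mulfK //.
  by rewrite expf_neq0 // pnatr_eq0 -lt0n.
rewrite -[X in (_ --> X)%classic]subr0; apply: cvgB; first exact: cvg_cst.
apply: cvg_geometric; rewrite ger0_norm ?invr_ge0 ?ler0n //.
by rewrite invf_lt1 ?ltr1n ?ltr0n.
Qed.

Theorem corollary3p7 (R : realType) (K : fieldType) (p : nat)
    (charK : p \in [pchar K]) (d : nat) :
  is_Fthreshold p (max_ideal K d) (diff_power (max_ideal K d)) (d%:R : R).
Proof.
have p_gt1 : (1 < p)%N := prime_gt1 (pcharf_prime charK).
set a := diff_power (max_ideal K d).
have cvg_nu : ((fun e => nu R p (max_ideal K d) a e / ((p ^ e)%N%:R)%:E)%E @ \oo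
    --> (d%:R : R)%:E)%classic.
  have -> : (fun e => nu R p (max_ideal K d) a e / ((p ^ e)%N%:R)%:E)%E =
      EFin \o (fun e => (d * (p ^ e - 1))%N%:R / (p ^ e)%N%:R : R).
    apply/funext => e /=; rewrite nu_max_ideal // inver pnatr_eq0 expn_eq0.
    by rewrite eqn0Ngt (ltnW p_gt1).
  by apply: cvg_EFin; [near=> e | exact: cvg_box_ratio].
have [lowerE upperE] := cvg_limn_einf_sup cvg_nu.
by split; [exact: ler0n | exact: upperE | exact: lowerE].
Unshelve. all: by end_near.
Qed.
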